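(* Let $I\subseteq\mathbb{R}$ be an open interval, $a\in I$, and $A:=C(I)$ the $\mathbb{R}$-algebra of continuous functions on $I$. Let $\Omega$ be a nonempty set and let $K_\omega(x,t)=k_\omega(x)h_\omega(t)\in C(I^2)$, $\omega\in\Omega$, be separable kernels with $k_\omega,h_\omega\in C(I)$ and $k_\omega$ zero free on $I$. Let $\rho_\omega:=P_{K_\omega}:A\to A$, $P_{K_\omega}(f)(x)=\int_a^xK_\omega(x,t)f(t)\,dt$, and $\rho_\Omega=(\rho_\omega\mid\omega\in\Omega)$. Let $Y$ be any set, and let $(\mathfrak{I}(\Omega,A[Y]),\Pi_\Omega)$ be the free $(A,\rho_\Omega)$-algebra over $B=\mathbb{R}[Y]$. Then every element of $\mathfrak{I}(\Omega,A[Y])$ (and its corresponding integral equation) is equivalent to one that is operator linear and in which each of the iterated operators acts on variable functions (that is, on functions in $A[Y]^+$). Explicitly: for every $\phi\in\mathfrak{I}(\Omega,A[Y])$ there is $\psi\in\mathfrak{I}(\Omega,A[Y])$ with $\phi-\psi\in J_{\rho_\Omega}$ such that $\psi$ is a finite sum of elements of the form $$u_0\,\Pi_{\omega_1}\big(u_1\,\Pi_{\omega_2}(u_2\cdots\Pi_{\omega_n}(u_n)\cdots)\big),\qquad n\ge0,\ u_0\in A[Y],\ u_1,\dots,u_n\in A[Y]^+,\ \omega_1,\dots,\omega_n\in\Omega.$$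
   Context: Here $\mathbf{k}=\mathbb{R}$; algebras are commutative and unital (except augmentation parts). $A[Y]=A\otimes\mathbb{R}[Y]$, $\mathbb{R}[Y]=\mathbb{R}\oplus\mathbb{R}[Y]^+$ with $\mathbb{R}[Y]^+$ the polynomials with zero constant term, and $A[Y]^+=A\otimes\mathbb{R}[Y]^+$, so $A[Y]=A\oplus A[Y]^+$. An $\Omega$-operated algebra is an algebra $V$ with linear maps $P_\omega:V\to V$, $\omega\in\Omega$; homomorphisms are algebra homomorphisms commuting with the operators. An $(A,\rho_\Omega)$-algebra is an $\Omega$-operated algebra $(R,P_\Omega)$ with an $\Omega$-operated algebra homomorphism $j_R:(A,\rho_\Omega)\to(R,P_\Omega)$; homomorphisms of $(A,\rho_\Omega)$-algebras are $\Omega$-operated homomorphisms compatible with the maps from $A$. Construction of $\mathfrak{I}(\Omega,A[Y])$. For a vector space $V$, $\lfloor V\rfloor_\omega$ is a copy of $V$ with linear bijection $v\mapsto\lfloor v\rfloor_\omega$, $\lfloor V\rfloor_\Omega=\bigoplus_\omega\lfloor V\rfloor_\omega$, $S(V)$ is the symmetric algebra and $S^+(V)=\bigoplus_{n\ge1}S^n(V)$. Set $\mathfrak{I}_0=A[Y]$, $\mathfrak{I}_0^+=A[Y]^+$ and, for $n\ge0$, $\mathfrak{I}_{n+1}=A[Y]\otimes S(\lfloor\mathfrak{I}_n^+\rfloor_\Omega)=A\oplus\mathfrak{I}^+_{n+1}$ with $\mathfrak{I}_{n+1}^+=A[Y]^+\oplus(A[Y]\otimes S^+(\lfloor\mathfrak{I}_n^+\rfloor_\Omega))$,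 with the natural inclusions $\mathfrak{I}_n\hookrightarrow\mathfrak{I}_{n+1}$, $\mathfrak{I}_n^+\hookrightarrow\mathfrak{I}_{n+1}^+$. Then $\mathfrak{I}(\Omega,A[Y])=\bigcup_n\mathfrak{I}_n=A\oplus\mathfrak{I}^+$ with $\mathfrak{I}^+=\bigcup_n\mathfrak{I}_n^+$, and $\Pi_\omega(u)=\rho_\omega(u)$ for $u\in A$, $\Pi_\omega(u)=\lfloor u\rfloor_\omega$ for $u\in\mathfrak{I}^+$. It is the free $(A,\rho_\Omega)$-algebra over $\mathbb{R}[Y]$: for any $(A,\rho_\Omega)$-algebra $(R,P_\Omega)$ and any algebra homomorphism $f:\mathbb{R}[Y]\to R$ (equivalently any map $Y\to R$) there is a unique $(A,\rho_\Omega)$-algebra homomorphism $\mathfrak{I}(\Omega,A[Y])\to R$ extending $f$. Equivalence. For each map $f_Y:Y\to A$, let $\bar f:\mathfrak{I}(\Omega,A[Y])\to A$ be the unique $(A,\rho_\Omega)$-algebra homomorphism (with $A$ regarded as an $(A,\rho_\Omega)$-algebra via the identity) extending $f_Y$ (evaluation map), and let $J_{\rho_\Omega,f_Y}=\ker\bar f$. Put $J_{\rho_\Omega}:=\bigcap_{f_Y:Y\to A}J_{\rho_\Omega,f_Y}$. Elements $\phi,\psi$ of $\mathfrak{I}(\Omega,A[Y])$ (or the equations $\phi=0$, $\psi=0$) are called equivalent if $\phi-\psi\in J_{\rho_\Omega}$. An integral equation is operator linear if every monomial in it is an iterated integral, i.e. contains no products of integral operators. *)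

(* Defs.v *)
From HB Require Import structures.
From mathcomp Require Import all_boot all_order all_algebra finmap.
From mathcomp Require Import all_classical all_reals all_analysis.
(* The notations of monalg clash with those of all_analysis. *)
From mathcomp Require Import -(notations) monalg.
From mathcomp Require Import generic_quotient.
Set Implicit Arguments.
Unset Strict Implicit.
Unset Printing Implicit Defensive.
Import Order.TTheory GRing.Theory Num.Theory.
Import numFieldNormedType.Exports.
Local Open Scope classical_set_scope.
Local Open Scope ring_scope.

(* R[Y] and A[Y] = A (x) R[Y]: the monoid algebra of the free commutative
   monoid on Y; no finiteness of Y is assumed. *)
Notation mvpoly R Y := (malg (cmonom Y) R).

Definition mvar {R : comNzRingType} {Y : choiceType} (y : Y) : mvpoly R Y :=
  mkmalgU (ucm y) 1.

Record operated_algebra (R : comNzRingType) (Omega : Type) := OperatedAlgebra {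
  oalg :> comAlgType R;
  oop : Omega -> {linear oalg -> oalg} }.
Arguments oop {R Omega o} w.

Definition is_operated_hom (R : comNzRingType) (Omega : Type)
    (U V : operated_algebra R Omega) (g : {lrmorphism U -> V}) : Prop :=
  forall w x, g (oop w x) = oop w (g x).

Record rho_algebra (R : comNzRingType) (Omega : Type)
    (A : operated_algebra R Omega) := RhoAlgebra {
  ralg :> operated_algebra R Omega;
  structure_map : {lrmorphism A -> ralg};
  structure_mapP : is_operated_hom structure_map }.
Arguments structure_map {R Omega A} r.

Section RhoAlgebras.
Context {R : comNzRingType} {Omega : Type} {A : operated_algebra R Omega}.

Definition is_rho_hom (S T : rho_algebra A) (g : {lrmorphism S -> T}) : Prop :=
  is_operated_hom g /\ forall x : A, g (structure_map S x) = structure_map T x.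

Lemma idfun_operated : is_operated_hom (idfun : {lrmorphism A -> A}).
Proof. by []. Qed.

Definition self_rho_algebra : rho_algebra A := RhoAlgebra idfun_operated.

Context {Y : choiceType}.

(* (F, i) is the free (A, rho)-algebra over R[Y]. It is unique up to
   isomorphism; free_rho_algebraP below constructs one. *)
Definition is_free_rho_algebra (F : rho_algebra A)
    (i : {lrmorphism mvpoly R Y -> F}) : Prop :=
  forall (S : rho_algebra A) (f : {lrmorphism mvpoly R Y -> S}),
    exists g : {lrmorphism F -> S},
      [/\ is_rho_hom g, (forall p, g (i p) = f p) &
          forall g' : {lrmorphism F -> S},
            is_rho_hom g' -> (forall p, g' (i p) = f p) -> g' =1 g].

Context {F : rho_algebra A} (i : {lrmorphism mvpoly R Y -> F}).

(* fbar is the evaluation at fY, which exists and is unique when F is free: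
   see evaluation_exists_unique. *)
Definition is_evaluation (fY : Y -> A)
    (fbar : {lrmorphism F -> self_rho_algebra}) : Prop :=
  is_rho_hom fbar /\ forall y, fbar (i (mvar y)) = fY y.

(* The intersection over all fY : Y -> A of the kernels of the evaluations. *)
Definition in_J (phi : F) : Prop :=
  forall (fY : Y -> A) (fbar : {lrmorphism F -> self_rho_algebra}),
    is_evaluation fY fbar -> fbar phi = 0.

Definition equivalent (phi psi : F) : Prop := in_J (phi - psi).

(* The canonical map A[Y] -> F, a (x) p |-> j(a) i(p). *)
Definition embed (u : mvpoly A Y) : F :=
  mmap (structure_map F) (fun m => i (mkmalgU m 1)) u.

(* A[Y]^+ *)
Definition in_plus (u : mvpoly A Y) : Prop := mcoeff mone u = 0.

(* u_1 Pi_{w_2}(u_2 ... Pi_{w_n}(u_n) ...) with all u_i in A[Y]^+ *)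
Inductive variable_iterated : F -> Prop :=
| VIbase u : in_plus u -> variable_iterated (embed u)
| VIstep u w z : in_plus u -> variable_iterated z ->
    variable_iterated (embed u * oop w z).

(* u_0 Pi_{w_1}(u_1 ... Pi_{w_n}(u_n) ...) with n >= 0, u_0 in A[Y] and
   u_1, ..., u_n in A[Y]^+ *)
Inductive iterated_integral : F -> Prop :=
| IIbase u0 : iterated_integral (embed u0)
| IIstep u0 w z : variable_iterated z ->
    iterated_integral (embed u0 * oop w z).

Definition operator_linear_on_variables (psi : F) : Prop :=
  exists (n : nat) (z : 'I_n -> F),
    (forall j, iterated_integral (z j)) /\ psi = \sum_j z j.

End RhoAlgebras.

Section PolyHom.
Context {R : comNzRingType} {Y : choiceType}.

Section MonEval.
Context {S : comAlgType R} (f : Y -> S).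

Definition mon_eval (m : cmonom Y) : S := \prod_(y <- finsupp m) f y ^+ m y.

Lemma mon_evalEw (m : cmonom Y) (d : {fset Y}) :
  (finsupp m `<=` d)%fset -> mon_eval m = \prod_(y <- d) f y ^+ m y.
Proof.
move=> le; rewrite /mon_eval [LHS](big_fset_incl _ le) //= => y _.
by rewrite memNfinsupp => /eqP ->.
Qed.

Lemma mon_eval_mmorphism : mmorphism (mon_eval : cmonom Y -> S).
Proof.
split=> [m1 m2|] /=; last by rewrite /mon_eval mdom1 big_seq_fset0.
rewrite {1}/mon_eval mdomD (mon_evalEw (fsubsetUl _ (finsupp m2))).
rewrite (mon_evalEw (fsubsetUr (finsupp m1) _)) -big_split /=.
by apply: eq_bigr => y _; rewrite cmM exprD.
Qed.

HB.instance Definition _ :=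
  monalg.isMultiplicative.Build (cmonom Y) S mon_eval mon_eval_mmorphism.

Lemma mon_evalU y : mon_eval (ucm y) = f y.
Proof. by rewrite /mon_eval mdomU big_seq_fset1 cmUU. Qed.

Definition poly_eval : mvpoly R Y -> S := mmap (in_alg S) mon_eval.

Lemma poly_eval_multiplicative : multiplicative poly_eval.
Proof. exact: mmap_is_multiplicative. Qed.

Lemma poly_eval_linear : linear poly_eval.
Proof.
by move=> c u v; rewrite /poly_eval raddfD /= mmapZ /= mulr_algl.
Qed.

HB.instance Definition _ :=
  GRing.isLinear.Build R (mvpoly R Y) S *:%R poly_eval poly_eval_linear.
HB.instance Definition _ :=
  GRing.isMultiplicative.Build (mvpoly R Y) S poly_eval
    poly_eval_multiplicative.

Lemma poly_evalX y : poly_eval (mvar y) = f y.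
Proof. by rewrite /poly_eval mmapU /= scale1r mul1r mon_evalU. Qed.

End MonEval.

Lemma mkmalgUM (m1 m2 : cmonom Y) :
  mkmalgU (mmul m1 m2) (1 : R) = mkmalgU m1 1 * mkmalgU m2 1.
Proof. by rewrite [RHS]fgmulUU mulr1. Qed.

Lemma mon_ind (P : cmonom Y -> Prop) : P mone ->
  (forall y m, P m -> P (mmul (ucm y) m)) -> forall m, P m.
Proof.
move=> P1 PM m; have [n] := ubnP (mdeg m); elim: n m => // n IH m.
have [->//|m1] := eqVneq m mone.
have [y my] : exists y, y \in finsupp m.
  apply/fset0Pn; apply: contraNneq m1 => m0.
  by rewrite -mdeg_eq0 mdegE m0 big_seq_fset0.
have E : m = mmul (ucm y) (divcm m (ucm y)).
  apply/eqP/cmP => z; rewrite cmM divcmE cmU.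
  case: eqVneq => [<-|_]; last by rewrite subn0.
  by rewrite subnKC // lt0n cmE_neq0.
by rewrite E mdegM mdegU => le; apply: PM; apply: IH.
Qed.

Lemma poly_hom_ext (S : comAlgType R) (g h : {lrmorphism mvpoly R Y -> S}) :
  (forall y, g (mvar y) = h (mvar y)) -> g =1 h.
Proof.
move=> gh u; rewrite (monalgE u) !raddf_sum; apply: eq_bigr => m _.
have -> : mkmalgU m (mcoeff m u) = mcoeff m u *: mkmalgU m 1.
  apply/malgP => k.
  rewrite mcoeffZ.
  have U (c : R) : mcoeff k (mkmalgU m c) = c *+ (m == k) by exact: mcoeffU.
  rewrite [LHS]U.
  rewrite [X in _ * X](U 1).
  by rewrite mulrnAr mulr1.
have Z (k : {lrmorphism mvpoly R Y -> S}) c v : k (c *: v) = c *: k v.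
  exact: linearZZ.
rewrite [LHS]Z [RHS]Z; congr (_ *: _).
elim/mon_ind: m => [|y m IH]; first by rewrite (rmorph1 g) (rmorph1 h).
rewrite mkmalgUM [LHS](rmorphM g) [RHS](rmorphM h).
by congr (_ * _); [exact: gh|exact: IH].
Qed.

End PolyHom.

Section Evaluation.
Context {R : comNzRingType} {Omega : Type} {A : operated_algebra R Omega}.
Context {Y : choiceType}.

Lemma evaluation_exists_unique (F : rho_algebra A)
    (i : {lrmorphism mvpoly R Y -> F}) (fY : Y -> A) :
  is_free_rho_algebra i ->
  exists2 fbar : {lrmorphism F -> self_rho_algebra}, is_evaluation i fY fbar &
    forall g : {lrmorphism F -> self_rho_algebra},
      is_evaluation i fY g -> g =1 fbar.
Proof.
move=> /(_ self_rho_algebra (poly_eval (fY : Y -> self_rho_algebra))).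
case=> g [gh gi gu]; exists g.
  by split=> // y; exact: etrans (gi _) (poly_evalX _ _).
move=> g' [g'h g'i]; apply: gu => // p.
apply: (@poly_hom_ext R Y _ (g' \o i)
  (poly_eval (fY : Y -> self_rho_algebra))) => y /=.
exact: etrans (g'i y) (esym (poly_evalX _ _)).
Qed.

End Evaluation.

(* Existence of the free (A, rho)-algebra over R[Y]: terms in A, Y, the ring
   operations and the operators, modulo the congruence generated by the axioms
   of (A, rho)-algebras. *)
Section FreeRhoAlgebra.
Context {R : comNzRingType} {Omega : Type} {A : operated_algebra R Omega}.
Context {Y : choiceType}.

Inductive term : Type :=
| TConst of A
| TVar of Y
| TAdd of term & term
| TMul of term & term
| TOp of Omega & term.

Local Notation TScale c t := (TMul (TConst c%:A) t).

Inductive teq : term -> term -> Prop :=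
| TErefl t : teq t t
| TEsym s t : teq s t -> teq t s
| TEtrans s t u : teq s t -> teq t u -> teq s u
| TEadd s s' t t' : teq s s' -> teq t t' -> teq (TAdd s t) (TAdd s' t')
| TEmul s s' t t' : teq s s' -> teq t t' -> teq (TMul s t) (TMul s' t')
| TEop w t t' : teq t t' -> teq (TOp w t) (TOp w t')
| TEaddA s t u : teq (TAdd s (TAdd t u)) (TAdd (TAdd s t) u)
| TEaddC s t : teq (TAdd s t) (TAdd t s)
| TEadd0 t : teq (TAdd (TConst 0) t) t
| TEaddN t : teq (TAdd (TScale (-1) t) t) (TConst 0)
| TEmulA s t u : teq (TMul s (TMul t u)) (TMul (TMul s t) u)
| TEmulC s t : teq (TMul s t) (TMul t s)
| TEmul1 t : teq (TMul (TConst 1) t) t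
| TEmulDl s t u : teq (TMul (TAdd s t) u) (TAdd (TMul s u) (TMul t u))
| TEconstD x y : teq (TConst (x + y)) (TAdd (TConst x) (TConst y))
| TEconstM x y : teq (TConst (x * y)) (TMul (TConst x) (TConst y))
| TEopD w s t : teq (TOp w (TAdd s t)) (TAdd (TOp w s) (TOp w t))
| TEopZ w c t : teq (TOp w (TScale c t)) (TScale c (TOp w t))
| TEopC w x : teq (TOp w (TConst x)) (TConst (oop w x)).

Fixpoint teval {S : rho_algebra A} (f : Y -> S) (t : term) : S :=
  match t with
  | TConst x => structure_map S x
  | TVar y => f y
  | TAdd s t => teval f s + teval f t
  | TMul s t => teval f s * teval f t
  | TOp w t => oop w (teval f t)
  end.

Lemma teval_teq (S : rho_algebra A) (f : Y -> S) s t :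
  teq s t -> teval f s = teval f t.
Proof.
elim=> {s t} //=.
- by move=> s t u _ -> _ ->.
- by move=> s s' t t' _ -> _ ->.
- by move=> s s' t t' _ -> _ ->.
- by move=> w t t' _ ->.
- by move=> *; rewrite addrA.
- by move=> *; rewrite addrC.
- by move=> *; rewrite raddf0 add0r.
- by move=> t; rewrite linearZ rmorph1 mulr_algl scaleN1r raddf0 addNr.
- by move=> *; rewrite mulrA.
- by move=> *; rewrite mulrC.
- by move=> *; rewrite rmorph1 mul1r.
- by move=> *; rewrite mulrDl.
- by move=> *; rewrite raddfD.
- by move=> *; rewrite rmorphM.
- by move=> *; rewrite raddfD.
- by move=> w c t; rewrite !linearZ rmorph1 !mulr_algl linearZ.
- by move=> w x; rewrite (structure_mapP S).
Qed.

HB.instance Definition _ := gen_eqMixin term.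
HB.instance Definition _ := gen_choiceMixin term.

Let teqb s t := `[< teq s t >].
Let teqb_refl : reflexive teqb. Proof. by move=> t; exact/asboolP/TErefl. Qed.
Let teqb_sym : symmetric teqb.
Proof. by move=> s t; apply/asboolP/asboolP => /TEsym. Qed.
Let teqb_trans : transitive teqb.
Proof.
by move=> t s u /asboolP st /asboolP tu; exact/asboolP/(TEtrans st tu).
Qed.
Canonical teqb_equiv := EquivRel teqb teqb_refl teqb_sym teqb_trans.

Definition freeT : Type := {eq_quot teqb}%qT.
HB.instance Definition _ := Choice.on freeT.

Let cl (t : term) : freeT := \pi_({eq_quot teqb})%qT t.
Let rep (x : freeT) : term := repr (x : {eq_quot teqb}%qT).

Let clP s t : cl s = cl t <-> teq s t.
Proof.
split; first by move/eqmodP => /asboolP.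
by move=> st; apply/eqmodP/asboolP.
Qed.

Let repK x : cl (rep x) = x. Proof. exact: reprK. Qed.
Let repP t : teq (rep (cl t)) t. Proof. by apply/clP; rewrite repK. Qed.
Let clE t s : teq s t -> cl s = cl t. Proof. by move/clP. Qed.

Let add x y := cl (TAdd (rep x) (rep y)).
Let mul x y := cl (TMul (rep x) (rep y)).
Let opp x := cl (TScale (-1) (rep x)).
Let zero := cl (TConst 0).
Let one := cl (TConst 1).
Let scale c x := cl (TScale c (rep x)).
Let op w x := cl (TOp w (rep x)).

Let addE s t : add (cl s) (cl t) = cl (TAdd s t).
Proof. by apply: clE; apply: TEadd; exact: repP. Qed.
Let mulE s t : mul (cl s) (cl t) = cl (TMul s t).
Proof. by apply: clE; apply: TEmul; exact: repP. Qed.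
Let oppE s : opp (cl s) = cl (TScale (-1) s).
Proof. by apply: clE; apply: TEmul; [exact: TErefl|exact: repP]. Qed.
Let scaleE c s : scale c (cl s) = cl (TScale c s).
Proof. by apply: clE; apply: TEmul; [exact: TErefl|exact: repP]. Qed.
Let opE w s : op w (cl s) = cl (TOp w s).
Proof. by apply: clE; apply: TEop; exact: repP. Qed.

Let addA : associative add.
Proof.
move=> x y z; rewrite -(repK x) -(repK y) -(repK z) !addE.
exact/clE/TEaddA.
Qed.
Let addC : commutative add.
Proof. by move=> x y; rewrite -(repK x) -(repK y) !addE; exact/clE/TEaddC. Qed.
Let add0 : left_id zero add.
Proof. by move=> x; rewrite -(repK x) addE; exact/clE/TEadd0. Qed.
Let addN : left_inverse zero opp add.
Proof. by move=> x; rewrite -(repK x) oppE addE; exact/clE/TEaddN. Qed.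
HB.instance Definition _ := GRing.isZmodule.Build freeT addA addC add0 addN.

Let mulA : associative mul.
Proof.
move=> x y z; rewrite -(repK x) -(repK y) -(repK z) !mulE.
exact/clE/TEmulA.
Qed.
Let mulC : commutative mul.
Proof. by move=> x y; rewrite -(repK x) -(repK y) !mulE; exact/clE/TEmulC. Qed.
Let mul1 : left_id one mul.
Proof. by move=> x; rewrite -(repK x) mulE; exact/clE/TEmul1. Qed.
Let mulDl : left_distributive mul add.
Proof.
move=> x y z; rewrite -(repK x) -(repK y) -(repK z) addE !mulE addE.
exact/clE/TEmulDl.
Qed.
Let one_neq0 : one != zero.
Proof.
apply/eqP => /clP /(@teval_teq self_rho_algebra (fun=> 0)) /= /eqP.
by rewrite oner_eq0.
Qed.
HB.instance Definition _ :=
  GRing.Zmodule_isComNzRing.Build freeT mulA mulC mul1 mulDl one_neq0.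

Let constM x y : cl (TConst (x * y)) = mul (cl (TConst x)) (cl (TConst y)).
Proof. by rewrite mulE; exact/clE/TEconstM. Qed.
Let constD x y : cl (TConst (x + y)) = add (cl (TConst x)) (cl (TConst y)).
Proof. by rewrite addE; exact/clE/TEconstD. Qed.
Let scaleM c x : scale c x = mul (cl (TConst c%:A)) x.
Proof. by rewrite -(repK x) scaleE mulE. Qed.

Let scaleA b c x : scale b (scale c x) = scale (b * c) x.
Proof. by rewrite !scaleM mulA -constM -scalerAl mul1r scalerA. Qed.
Let scale1 : left_id 1 scale.
Proof. by move=> x; rewrite scaleM scale1r; exact: mul1. Qed.
Let scaleDr : right_distributive scale +%R.
Proof.
move=> c x y; rewrite !scaleM.
by rewrite (mulC _ (x + y)) (mulC _ x) (mulC _ y); exact: mulDl.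
Qed.
Let scaleDl x : {morph scale^~ x : b c / b + c}.
Proof. by move=> b c; rewrite /= !scaleM scalerDl constD mulDl. Qed.
HB.instance Definition _ :=
  GRing.Zmodule_isLmodule.Build R freeT scaleA scale1 scaleDr scaleDl.

Let scaleAl c (x y : freeT) : c *: (x * y) = c *: x * y.
Proof. by rewrite [LHS]scaleM [c *: x]scaleM; exact: mulA. Qed.
HB.instance Definition _ := GRing.Lmodule_isLalgebra.Build R freeT scaleAl.
HB.instance Definition _ := GRing.Lalgebra_isComAlgebra.Build R freeT.

Let op_linear w : linear (op w : freeT -> freeT).
Proof.
move=> c x y; rewrite -(repK x) -(repK y).
rewrite [c *: cl _]scaleE [X in op _ X]addE !opE.
rewrite [c *: cl _]scaleE [RHS]addE.
by apply: clE; apply: TEtrans (TEopD _ _ _) (TEadd (TEopZ _ _ _) (TErefl _)).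
Qed.
HB.instance Definition _ w :=
  GRing.isLinear.Build R freeT freeT *:%R (op w) (op_linear w).

Definition free_operated : operated_algebra R Omega :=
  @OperatedAlgebra R Omega freeT (fun w => op w).

Definition free_const (x : A) : freeT := cl (TConst x).

Let free_const_linear : linear free_const.
Proof.
move=> c x y; rewrite /free_const constD -[c *: x]mulr_algl constM -scaleM.
by [].
Qed.
HB.instance Definition _ :=
  GRing.isLinear.Build R A freeT *:%R free_const free_const_linear.
Let free_const_multiplicative : multiplicative free_const.
Proof. by split=> // x y; exact: constM. Qed.
HB.instance Definition _ :=
  GRing.isMultiplicative.Build A freeT free_const free_const_multiplicative.

Lemma free_const_operated :
  @is_operated_hom R Omega A free_operated free_const.
Proof. by move=> w x /=; rewrite /free_const opE; exact/clE/TEsym/TEopC. Qed.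

Definition free_rho_algebra : rho_algebra A :=
  @RhoAlgebra R Omega A free_operated free_const free_const_operated.

Definition free_var : {lrmorphism mvpoly R Y -> free_rho_algebra} :=
  poly_eval (fun y => cl (TVar y) : free_rho_algebra).

Section Lift.
Context {S : rho_algebra A} (f : Y -> S).

Definition free_lift (x : free_rho_algebra) : S := teval f (rep x).

Lemma free_liftE t : free_lift (cl t) = teval f t.
Proof. by apply: teval_teq; exact: repP. Qed.

Let lift_linear : linear free_lift.
Proof.
move=> c x y; rewrite -(repK x) -(repK y) [c *: cl _]scaleE [cl _ + _]addE.
by rewrite !free_liftE /= linearZ rmorph1 mulr_algl.
Qed.
HB.instance Definition _ :=
  GRing.isLinear.Build R free_rho_algebra S *:%R free_lift lift_linear.
Let lift_multiplicative : multiplicative free_lift.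
Proof.
split=> [x y|]; last by rewrite [1]/(cl _) free_liftE /= rmorph1.
by rewrite -(repK x) -(repK y) [cl _ * _]mulE !free_liftE.
Qed.
HB.instance Definition _ :=
  GRing.isMultiplicative.Build free_rho_algebra S free_lift
    lift_multiplicative.

Lemma free_lift_rho_hom : is_rho_hom (free_lift : {lrmorphism _ -> _}).
Proof.
split=> [w x|x] /=; last by rewrite [free_const x]/(cl _) free_liftE.
by rewrite -(repK x) [op w _]opE !free_liftE.
Qed.
End Lift.

Lemma free_rho_algebraP : is_free_rho_algebra free_var.
Proof.
move=> S f; pose f1 y := f (mvar y).
exists (free_lift f1); split; first exact: free_lift_rho_hom.
  apply: (@poly_hom_ext R Y S (free_lift f1 \o free_var) f) => y /=.
  by rewrite [free_var _]poly_evalX free_liftE.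
move=> g [gop gst] gf x; rewrite -(repK x) [RHS]free_liftE.
elim: (rep x) => [b|y|s IHs t IHt|s IHs t IHt|w t IHt] /=.
- exact: gst.
- by rewrite -[RHS]gf [free_var _]poly_evalX.
- by rewrite -addE -IHs -IHt -[RHS]raddfD.
- by rewrite -mulE -IHs -IHt -[RHS]rmorphM.
- by rewrite -opE -IHt -[RHS]gop.
Qed.

End FreeRhoAlgebra.

Record open_interval (R : realType) := OpenInterval {
  oi_set :> set R;
  oi_open : open oi_set;
  oi_itv : is_interval oi_set }.

(* C(I), with the subspace topology on I. The base point a makes I nonempty,
   which is what 1 != 0 in C(I) requires. *)
Record CI (R : realType) (I : open_interval R) (a : I) := MkCI {
  CIfun :> I -> R;
  CI_continuous : continuous CIfun }.
Arguments MkCI {R I a CIfun} CI_continuous.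

HB.instance Definition _ (R : realType) (I : open_interval R) (a : I) :=
  gen_eqMixin (CI a).
HB.instance Definition _ (R : realType) (I : open_interval R) (a : I) :=
  gen_choiceMixin (CI a).

Section ContinuousFunctions.
Context {R : realType} {I : open_interval R} {a : I}.
Implicit Types (f g : CI a) (c : R).

Lemma CIext f g : (forall x, f x = g x) -> f = g.
Proof.
case: f g => [f cf] [g cg] /= /funext fg; case: g / fg in cg *.
by congr MkCI; exact: Prop_irrelevance.
Qed.

Let ro f : (I : topologicalType) -> R^o := f.
Lemma CI0_subproof : continuous (fun _ : I => 0 : R).
Proof. exact: cst_continuous. Qed.
Lemma CI1_subproof : continuous (fun _ : I => 1 : R).
Proof. exact: cst_continuous. Qed.
Lemma CIN_subproof f : continuous (fun x => - f x).
Proof.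
by move=> x; refine (@continuousN _ _ _ (ro f) x _); exact: CI_continuous.
Qed.
Lemma CID_subproof f g : continuous (fun x => f x + g x).
Proof.
by move=> x; refine (@continuousD _ _ _ (ro f) (ro g) x _ _);
  exact: CI_continuous.
Qed.
Lemma CIM_subproof f g : continuous (fun x => f x * g x).
Proof.
by move=> x; refine (@continuousM _ _ (ro f) (ro g) x _ _);
  exact: CI_continuous.
Qed.
Lemma CIZ_subproof c f : continuous (fun x => c * f x).
Proof.
move=> x; refine (@continuousM _ _ (cst c) (ro f) x _ _);
  [exact: cst_continuous|exact: CI_continuous].
Qed.

Let add f g : CI a := MkCI (@CID_subproof f g).
Let mul f g : CI a := MkCI (@CIM_subproof f g).
Let opp f : CI a := MkCI (@CIN_subproof f).
Let zero : CI a := MkCI CI0_subproof.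
Let one : CI a := MkCI CI1_subproof.
Let scale c f : CI a := MkCI (@CIZ_subproof c f).

Let addA : associative add.
Proof. by move=> f g h; apply: CIext => x; exact: addrA. Qed.
Let addC : commutative add.
Proof. by move=> f g; apply: CIext => x; exact: addrC. Qed.
Let add0 : left_id zero add.
Proof. by move=> f; apply: CIext => x; exact: add0r. Qed.
Let addN : left_inverse zero opp add.
Proof. by move=> f; apply: CIext => x; exact: addNr. Qed.
HB.instance Definition _ := GRing.isZmodule.Build (CI a) addA addC add0 addN.

Let mulA : associative mul.
Proof. by move=> f g h; apply: CIext => x; exact: mulrA. Qed.
Let mulC : commutative mul.
Proof. by move=> f g; apply: CIext => x; exact: mulrC. Qed.
Let mul1 : left_id one mul.
Proof. by move=> f; apply: CIext => x; exact: mul1r. Qed.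
Let mulDl : left_distributive mul add.
Proof. by move=> f g h; apply: CIext => x; exact: mulrDl. Qed.
Let one_neq0 : one != 0.
Proof.
by apply/eqP => /(congr1 (fun f : CI a => f a)) /eqP; rewrite oner_eq0.
Qed.
HB.instance Definition _ :=
  GRing.Zmodule_isComNzRing.Build (CI a) mulA mulC mul1 mulDl one_neq0.

Let scaleA b c f : scale b (scale c f) = scale (b * c) f.
Proof. by apply: CIext => x; exact: mulrA. Qed.
Let scale1 : left_id 1 scale.
Proof. by move=> f; apply: CIext => x; exact: mul1r. Qed.
Let scaleDr : right_distributive scale +%R.
Proof. by move=> c f g; apply: CIext => x; exact: mulrDr. Qed.
Let scaleDl f : {morph scale^~ f : b c / b + c}.
Proof. by move=> b c; apply: CIext => x; exact: mulrDl. Qed.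
HB.instance Definition _ :=
  GRing.Zmodule_isLmodule.Build R (CI a) scaleA scale1 scaleDr scaleDl.

Let scaleAl c f g : c *: (f * g) = c *: f * g.
Proof. by apply: CIext => x; exact: mulrA. Qed.
HB.instance Definition _ := GRing.Lmodule_isLalgebra.Build R (CI a) scaleAl.
HB.instance Definition _ := GRing.Lalgebra_isComAlgebra.Build R (CI a).

Lemma CIDE f g x : (f + g) x = f x + g x. Proof. by []. Qed.
Lemma CIME f g x : (f * g) x = f x * g x. Proof. by []. Qed.
Lemma CIZE c f x : (c *: f) x = c * f x. Proof. by []. Qed.

End ContinuousFunctions.

Section Volterra.
Context {R : realType}.
Local Notation mu := (@lebesgue_measure R).

Definition oriented_integral (a b : R) (g : R -> R) : R :=
  if a <= b then \int[mu]_(t in `[a, b]) g t else - \int[mu]_(t in `[b, a]) g t.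

Context {I : open_interval R}.

(* The integral of K(x,t) f(t) for t from a to x. The integrand lives on I;
   'valL_0 extends it by 0 to R, and only its values between a and x, hence
   in I, are used. *)
Definition volterra (a : I) (K : I -> I -> R) (f : I -> R) (x : I) : R :=
  oriented_integral (\val a) (\val x) ('valL_0 (fun t : I => K x t * f t)).

Lemma oi_sub (p q : R) :
  oi_set I p -> oi_set I q -> `[p, q]%classic `<=` oi_set I.
Proof. by move=> Ip Iq z /=; rewrite in_itv /=; exact: oi_itv. Qed.

Lemma oi_integrable (g : R -> R) (p q : R) :
  {within (oi_set I), continuous g} -> oi_set I p -> oi_set I q ->
  mu.-integrable `[p, q] (EFin \o g).
Proof.
move=> cg Ip Iq; apply: continuous_compact_integrable.
  exact: segment_compact.
exact: continuous_subspaceW (oi_sub Ip Iq) cg.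
Qed.

Lemma oriented_integral_shift (g : R -> R) (p a b : R) :
  {within (oi_set I), continuous g} -> oi_set I p -> oi_set I a -> oi_set I b ->
  p <= a -> p <= b ->
  oriented_integral a b g =
  \int[mu]_(t in `[p, b]) g t - \int[mu]_(t in `[p, a]) g t.
Proof.
move=> cg Ip Ia Ib pa pb; rewrite /oriented_integral.
have key c d : oi_set I c -> oi_set I d -> p <= c -> c <= d ->
    \int[mu]_(t in `[p, d]) g t - \int[mu]_(t in `[p, c]) g t =
    \int[mu]_(t in `[c, d]) g t.
  move=> Ic Id pc cd.
  rewrite (@Rintegral_itvB _ g (BLeft p) (BRight d) c) ?bnd_simp//; last first.
    exact: oi_integrable.
  rewrite Rintegral_itv_obnd_cbnd//.
  have := oi_integrable cg Ic Id.
  by apply: integrableS => //; apply: subset_itvr; rewrite bnd_simp.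
case: (leP a b) => [ab|/ltW ba]; first by rewrite key.
by rewrite -(key b a)// opprB.
Qed.

Lemma oriented_integral_continuous (g : R -> R) (a x : R) :
  {within (oi_set I), continuous g} -> oi_set I a -> oi_set I x ->
  {for x, continuous (fun y => oriented_integral a y g)}.
Proof.
move=> cg Ia Ix.
have [e /= e0 eI] : exists2 e : R, 0 < e & ball x e `<=` oi_set I.
  have /nbhs_ballP[e e0 he] := open_nbhs_nbhs (conj (@oi_open R I) Ix).
  by exists e.
pose c := x - e / 2; pose d := x + e / 2.
have e2 : 0 < e / 2 by rewrite divr_gt0.
have e2e : e / 2 < e by rewrite ltr_pdivrMr// ltr_pMr// ltr1n.
have Ic : oi_set I c.
  by apply: eI; rewrite /ball /= /c subKr gtr0_norm.
have Id : oi_set I d.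
  by apply: eI; rewrite /ball /= /d opprD addNKr normrN gtr0_norm.
have cx : c < x by rewrite /c ltrBlDr ltrDl.
have xd : x < d by rewrite /d ltrDl.
pose p := Num.min a c.
have Ip : oi_set I p by rewrite /p /Num.min; case: ifP.
have px : p < x by rewrite /p gt_min cx orbT.
have pa : p <= a by rewrite /p ge_min lexx.
have pd : p <= d by rewrite (le_trans (ltW px)) // ltW.
have H : {for x, continuous (fun y =>
    \int[mu]_(t in `[p, y]) g t - \int[mu]_(t in `[p, a]) g t)}.
  apply: cvgB; last exact: cvg_cst.
  have H := parameterized_integral_continuous pd (oi_integrable cg Ip Id).
  apply: (within_continuous_continuous (lt_trans px xd) H).
  by rewrite in_itv/= px xd.
rewrite /prop_for /continuous_at.
rewrite (oriented_integral_shift cg Ip Ia Ix pa (ltW px)).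
apply: cvg_trans H; apply: near_eq_cvg; near=> y.
have : y \in `]p, d[.
  by near: y; apply: near_in_itvoo; rewrite in_itv/= px xd.
rewrite in_itv/= => /andP[py yd].
have Iy : oi_set I y.
  by apply: (oi_sub Ip Id); rewrite /= in_itv/= (ltW py) (ltW yd).
by rewrite (oriented_integral_shift cg Ip Ia Iy pa (ltW py)).
Unshelve. all: by end_near. Qed.

End Volterra.

Section Rho.
Context {R : realType} {I : open_interval R} {a : I}.
Implicit Types (k h f : CI a).
Local Notation mu := (@lebesgue_measure R).

Definition separable_kernel k h (x t : I) : R := k x * h t.

Lemma valL_CI_continuous f : {within (oi_set I), continuous ('valL_0 f)}.
Proof. by apply/subspace_valL_continuousP'; exact: CI_continuous. Qed.

Lemma volterra_separableE k h f x :
  volterra a (separable_kernel k h) f x =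
  k x * oriented_integral (\val a) (\val x) ('valL_0 (h * f)).
Proof.
rewrite /volterra /separable_kernel.
have Ix := set_mem (valP x); have Ia := set_mem (valP a).
have E : 'valL_0 (fun t => k x * h t * f t) = fun t => k x * 'valL_0 (h * f) t.
  apply/funext => t /=; case: ('oinv_set_val t) => [s|] /=;
    last by rewrite mulr0.
  by rewrite mulrA.
rewrite E /oriented_integral.
have vc := @valL_CI_continuous (h * f).
by case: ifP => _; rewrite RintegralZl ?mulrN//; exact: oi_integrable.
Qed.

Lemma volterra_continuous k h f :
  continuous (volterra a (separable_kernel k h) f).
Proof.
rewrite (_ : volterra _ _ _ = fun x => k x *
  oriented_integral (\val a) (\val x) ('valL_0 (h * f))); last first.
  by apply/funext => x; exact: volterra_separableE.
move=> x; refine (@continuousM R I k (fun x => oriented_integral (\val a)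
  (\val x) ('valL_0 (h * f)) : R^o) x _ _); first exact: CI_continuous.
have Ix := set_mem (valP x); have Ia := set_mem (valP a).
have H := oriented_integral_continuous (@valL_CI_continuous (h * f)) Ia Ix.
apply: (@continuous_comp _ _ _ (set_val : I -> R)
  (fun y => oriented_integral (\val a) y ('valL_0 (h * f)))).
  exact: initial_continuous.
exact: H.
Qed.

Definition volterra_op k h f : CI a := MkCI (@volterra_continuous k h f).

Lemma volterra_opE k h f x : volterra_op k h f x =
  k x * oriented_integral (\val a) (\val x) ('valL_0 (h * f)).
Proof. exact: volterra_separableE. Qed.

Lemma volterra_op_linear k h : linear (volterra_op k h).
Proof.
move=> c f g; apply: CIext => x; rewrite CIDE CIZE.
rewrite !volterra_opE.
have Ix := set_mem (valP x); have Ia := set_mem (valP a).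
have vf := @valL_CI_continuous (h * f); have vg := @valL_CI_continuous (h * g).
rewrite mulrCA -mulrDr; congr (_ * _).
rewrite [in LHS](_ : 'valL_0 _ =
    fun t => c * 'valL_0 (h * f) t + 'valL_0 (h * g) t); last first.
  apply/funext => t /=; case: ('oinv_set_val t) => [s|] /=; last first.
    by rewrite mulr0 addr0.
  by rewrite mulrDr mulrCA.
rewrite /oriented_integral.
have vcf : {within oi_set I, continuous (fun t => c * 'valL_0 (h * f) t)}.
  rewrite (_ : (fun t => _) = 'valL_0 (c *: (h * f))).
    exact: valL_CI_continuous.
  by apply/funext => t /=; case: ('oinv_set_val t) => [s|] //=; rewrite mulr0.
have D p q : oi_set I p -> oi_set I q ->
  \int[mu]_(t in `[p, q]) (c * 'valL_0 (h * f) t + 'valL_0 (h * g) t) =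
  c * \int[mu]_(t in `[p, q]) 'valL_0 (h * f) t
    + \int[mu]_(t in `[p, q]) 'valL_0 (h * g) t.
  move=> Ip Iq; rewrite RintegralD//=; last 2 first.
  - exact: oi_integrable.
  - exact: oi_integrable.
  by rewrite RintegralZl//; exact: oi_integrable.
by case: ifP => _; rewrite D// opprD mulrN.
Qed.

HB.instance Definition _ k h :=
  GRing.isLinear.Build R (CI a) (CI a) *:%R (volterra_op k h)
    (volterra_op_linear k h).

Definition volterra_algebra {Omega : Type} (k h : Omega -> CI a) :
    operated_algebra R Omega :=
  @OperatedAlgebra R Omega (CI a) (fun w => volterra_op (k w) (h w)).

End Rho.

(* Main.v *)
Require Import Defs.
From HB Require Import structures.
From mathcomp Require Import all_boot all_order all_algebra finmap.
From mathcomp Require Import all_classical all_reals all_analysis.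
From mathcomp Require Import -(notations) monalg.
Set Implicit Arguments.
Unset Strict Implicit.
Unset Printing Implicit Defensive.
Import Order.TTheory GRing.Theory Num.Theory.
Import numFieldNormedType.Exports.
Local Open Scope classical_set_scope.
Local Open Scope ring_scope.

(** Two elements are equivalent as soon as all their evaluations in C(I) agree,
so every identity between Volterra operators is a rewriting rule modulo J, and
one such identity suffices.  Write P_v(f) = k_v Q(h_v f), where Q is
integration from a.  Integration by parts, Q(f) Q(g) = Q(f Q(g)) + Q(g Q(f))
([primitiveM]), becomes, since each k_v is invertible, the twisted Rota-Baxter
identity ([volterra_rota_baxter])

  P_v(f) P_w(g) = k_w P_v(k_w^-1 f P_w(g)) + k_v P_w(k_v^-1 g P_v(f)).

Products: the identity rewrites a product of two integrals Pi_v(z) Pi_w(z') in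
terms of integrals of z Pi_w(z') and z' Pi_v(z), which contain fewer operators
under the product sign; by induction on both factors, products of operators
disappear ([spanned_op_mul]).

Coefficients: applying an operator to u_0 Pi_v(z) turns u_0 into an inner
factor, where its constant term c in A is not allowed.  Taking g = c k_v in the
identity makes the second term k_v P_w(c P_v(f)), and solving for it gives

  P_w(c P_v(f)) = k_v^-1 P_w(c k_v) P_v(f)
                  - k_v^-1 k_w P_v(k_w^-1 P_w(c k_v) f),

where P_w(c k_v) is a function in A; so a constant factor can always be pushed
out of an integral ([equivalent_op_op], [integral_sum_op]).

Hence the elements equivalent to sums of admissible iterated integrals form a
subalgebra stable under the operators and containing A and Y.  A free
(A, rho)-algebra is generated by A and Y ([free_rho_algebra_generated]), so
every element is of this kind. *)

(** * Equivalence and the map from A[Y] *)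

Section Reduction.
Context {R : comNzRingType} {Omega : Type} {A : operated_algebra R Omega}.
Context {Y : choiceType} {F : rho_algebra A} (i : {lrmorphism mvpoly R Y -> F}).

Local Notation j := (structure_map F).

(** The factor m |-> i(m) of [embed], named so that it can carry the structure
of a monoid morphism, from which multiplicativity of [embed] follows. *)
Definition monomial_image (m : cmonom Y) : F := i (mkmalgU m 1).

Lemma equivalentP (x y : F) : equivalent i x y <->
  forall fY fbar, is_evaluation i fY fbar -> fbar x = fbar y.
Proof.
split=> xy fY fbar /xy.
  by rewrite raddfB => /eqP; rewrite subr_eq0 => /eqP.
by move=> E; apply/eqP; rewrite raddfB subr_eq0; exact/eqP.
Qed.

Lemma equivalent_refl (x : F) : equivalent i x x.
Proof. exact/equivalentP. Qed.

Lemma equivalent_trans (x y z : F) :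
  equivalent i x y -> equivalent i y z -> equivalent i x z.
Proof.
move=> /equivalentP xy /equivalentP yz; apply/equivalentP => fY fbar ev.
by rewrite (xy _ _ ev) (yz _ _ ev).
Qed.

Lemma equivalentD (x x' y y' : F) : equivalent i x x' -> equivalent i y y' ->
  equivalent i (x + y) (x' + y').
Proof.
move=> /equivalentP xx /equivalentP yy; apply/equivalentP => fY fbar ev.
by rewrite !raddfD; congr (_ + _); [exact: xx ev|exact: yy ev].
Qed.

Lemma equivalentM (x x' y y' : F) : equivalent i x x' -> equivalent i y y' ->
  equivalent i (x * y) (x' * y').
Proof.
move=> /equivalentP xx /equivalentP yy; apply/equivalentP => fY fbar ev.
by rewrite !rmorphM; congr (_ * _); [exact: xx ev|exact: yy ev].
Qed.

Lemma equivalent_op w (x x' : F) : equivalent i x x' ->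
  equivalent i (oop w x) (oop w x').
Proof.
move=> /equivalentP xx; apply/equivalentP => fY fbar ev.
by have [[hw _] _] := ev; rewrite !hw (xx _ _ ev).
Qed.

Lemma monomial_image_mmorphism : mmorphism monomial_image.
Proof.
split=> [m1 m2|] /=; last exact: rmorph1.
by rewrite /monomial_image mkmalgUM; exact: rmorphM.
Qed.

HB.instance Definition _ := monalg.isMultiplicative.Build (cmonom Y) F
  monomial_image monomial_image_mmorphism.

Lemma embedD (u v : mvpoly A Y) : embed i (u + v) = embed i u + embed i v.
Proof. exact: raddfD. Qed.

Lemma embedM (u v : mvpoly A Y) : embed i (u * v) = embed i u * embed i v.
Proof.
have [+ _] : multiplicative (mmap j monomial_image).
  exact: mmap_is_multiplicative.
by apply.
Qed.

Lemma embedC (c : A) : embed i (mkmalgU mone c) = j c.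
Proof. by rewrite /embed mmapU -[RHS]mulr1; congr (_ * _); exact: rmorph1. Qed.

Lemma embedX (y : Y) : embed i (mvar y) = i (mvar y).
Proof. by rewrite /embed mmapU -[RHS]mul1r; congr (_ * _); exact: rmorph1. Qed.

Lemma in_plusMl (u v : mvpoly A Y) : in_plus u -> in_plus (u * v).
Proof.
rewrite /in_plus => u0.
have [+ _] := @mcoeff1g_is_multiplicative (cmonom Y) A.
by move=> ->; rewrite u0 mul0r.
Qed.

Lemma in_plusB_const (u : mvpoly A Y) :
  in_plus (u - mkmalgU mone (mcoeff mone u)).
Proof. by rewrite /in_plus mcoeffB mcoeffUU subrr. Qed.

(** * Sums of elements of a given kind, modulo equivalence *)

(** Closing under equivalence inside the inductive definition lets one
rewrite modulo J at any point of a reduction; the representative itself is only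
extracted at the very end, by [spannedE]. *)
Inductive spanned (P : F -> Prop) : F -> Prop :=
| spanned_gen x : P x -> spanned P x
| spanned0 : spanned P 0
| spannedD x y : spanned P x -> spanned P y -> spanned P (x + y)
| spanned_equiv x y : equivalent i x y -> spanned P y -> spanned P x.

(** An additive map that respects equivalence is controlled by its values on
generators; this turns each closure property into a check on single iterated
integrals. *)
Lemma spanned_map (P Q : F -> Prop) (g : F -> F) :
  additive g ->
  (forall x y, equivalent i x y -> equivalent i (g x) (g y)) ->
  (forall x, P x -> spanned Q (g x)) ->
  forall x, spanned P x -> spanned Q (g x).
Proof.
move=> gB gE PQ x.
have g0 : g 0 = 0 by rewrite -[X in g X](subrr 0) gB subrr.
have gD y z : g (y + z) = g y + g z.
  by rewrite -[z in LHS]opprK -[- z]sub0r !gB g0 sub0r opprK.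
elim=> {x} [x /PQ//||x y _ Qx _ Qy|x y xy _ Qy].
- by rewrite g0; exact: spanned0.
- by rewrite gD; exact: spannedD.
- exact: spanned_equiv (gE _ _ xy) Qy.
Qed.

Lemma spannedE (P : F -> Prop) x : spanned P x ->
  exists y, equivalent i x y /\
    exists n (z : 'I_n -> F), (forall q, P (z q)) /\ y = \sum_q z q.
Proof.
move=> Px; suff [s Ps xs] : exists2 s : seq F,
    forall z, z \in s -> P z & equivalent i x (\sum_(z <- s) z).
  exists (\sum_(z <- s) z); split=> //.
  exists (size s), (tnth (in_tuple s)); split; last exact: big_tnth.
  by move=> q; apply: Ps; exact: mem_tnth.
elim: Px => {x} [x Px||x y _ [s Ps xs] _ [t Pt yt]|x y xy _ [s Ps ys]].
- exists [:: x]; first by move=> z; rewrite inE => /eqP ->.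
  by rewrite big_seq1; exact: equivalent_refl.
- by exists [::] => //; rewrite big_nil; exact: equivalent_refl.
- exists (s ++ t); last by rewrite big_cat; exact: equivalentD.
  by move=> z; rewrite mem_cat => /orP[/Ps|/Pt].
- by exists s => //; exact: equivalent_trans ys.
Qed.

Lemma spanned_mul_op (P Q : F -> Prop) u w c :
  (forall z, P z -> spanned Q (embed i u * oop w (j c * z))) ->
  forall x, spanned P x -> spanned Q (embed i u * oop w (j c * x)).
Proof.
apply: spanned_map => [x y|x y xy]; first by rewrite !(raddfB, mulrBr).
apply: equivalentM; first exact: equivalent_refl.
by apply/equivalent_op/equivalentM => //; exact: equivalent_refl.
Qed.

Lemma spanned_mull (P Q : F -> Prop) t :
  (forall z, P z -> spanned Q (t * z)) ->
  forall x, spanned P x -> spanned Q (t * x).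
Proof.
apply: spanned_map => [x y|x y xy]; first exact: mulrBr.
by apply: equivalentM => //; exact: equivalent_refl.
Qed.

Lemma variable_iteratedZ (c : A) z : variable_iterated i z ->
  variable_iterated i (j c * z).
Proof.
have Z (u : mvpoly A Y) : in_plus u -> in_plus (mkmalgU mone c * u).
  by move=> up; rewrite mulrC; exact: in_plusMl.
case=> [u /Z up|u w {}z /Z up vz]; rewrite -embedC ?mulrA -embedM.
  exact: VIbase.
exact: VIstep.
Qed.

(** * Products of iterated integrals *)

(** Products of integrals are reduced to this kind of element rather than to
[variable_iterated] ones because the identity brings out factors k_w in front,
where constants are harmless. *)
Inductive proper_iterated : F -> Prop :=
| ProperIterated u w z :
    variable_iterated i z -> proper_iterated (embed i u * oop w z).

(** The front coefficient v of a proper iterated integral is absorbed by u, and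
u * v has no constant term because u has none: this is why the products met in
the induction stay admissible as integrands. *)
Lemma spanned_variable_iteratedM u x : in_plus u -> spanned proper_iterated x ->
  spanned (variable_iterated i) (embed i u * x).
Proof.
move=> up; apply: spanned_mull => _ [v w z vz]; rewrite mulrA -embedM.
by apply/spanned_gen/VIstep => //; exact: in_plusMl.
Qed.

Context {k kinv : Omega -> A}.
Context (kK : forall w, k w * kinv w = 1).
Context (rota_baxter : forall v w (f g : A),
  oop v f * oop w g = k w * oop v (kinv w * (f * oop w g)) +
                      k v * oop w (kinv v * (g * oop v f))).

Lemma equivalent_op_mul v w (x y : F) : equivalent i (oop v x * oop w y)
  (j (k w) * oop v (j (kinv w) * (x * oop w y)) +
   j (k v) * oop w (j (kinv v) * (y * oop v x))).
Proof.
apply/equivalentP => fY fbar [[hw hj] _].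
have hM x' y' : fbar (x' * y') = fbar x' * fbar y' by exact: rmorphM.
have hD x' y' : fbar (x' + y') = fbar x' + fbar y' by exact: raddfD.
have {}hw w' x' : fbar (oop w' x') = oop w' (fbar x') by exact: hw.
rewrite hD !hM !hw !hM !hj !hw; exact: rota_baxter.
Qed.

(** The Rota-Baxter identity at g = c k_v, solved for its last term. *)
Lemma nested_op w v (c f : A) : oop w (c * oop v f) =
  kinv v * oop w (c * k v) * oop v f -
  kinv v * k w * oop v (kinv w * oop w (c * k v) * f).
Proof.
have VK x : kinv v * (k v * x) = x by rewrite mulrA [kinv v * _]mulrC kK mul1r.
have -> : kinv v * oop w (c * k v) * oop v f =
    kinv v * (oop v f * oop w (c * k v)).
  by rewrite [oop v f * _]mulrC mulrA.
rewrite rota_baxter mulrDr VK [kinv v * (k w * _)]mulrA [f * _]mulrC.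
rewrite [kinv w * (_ * f)]mulrA [X in X - _]addrC addrK; congr (oop w _).
by rewrite [c * k v]mulrC -mulrA VK.
Qed.

Lemma equivalent_op_op w v (c : A) (x : F) :
  equivalent i (oop w (j c * oop v x))
  (j (kinv v * oop w (c * k v)) * oop v x -
   j (kinv v * k w) * oop v (j (kinv w * oop w (c * k v)) * x)).
Proof.
apply/equivalentP => fY fbar [[hw hj] _].
have hM x' y' : fbar (x' * y') = fbar x' * fbar y' by exact: rmorphM.
have hB x' y' : fbar (x' - y') = fbar x' - fbar y' by exact: raddfB.
have {}hw w' x' : fbar (oop w' x') = oop w' (fbar x') by exact: hw.
rewrite hB !hw !hM !hj !hw !hM !hj.
exact: nested_op.
Qed.

(** By [equivalent_op_mul] it suffices that z Pi_w(z') and z' Pi_v(z) are sums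
of [variable_iterated] elements.  If z is in A[Y]^+ the first already is one; if
z = u Pi(z1) it is u times the product Pi(z1) Pi_w(z'), which is smaller in the
first factor.  The second is symmetric, hence a nested induction. *)
Lemma spanned_op_mul z z' : variable_iterated i z -> variable_iterated i z' ->
  forall v w, spanned proper_iterated (oop v z * oop w z').
Proof.
have coef c w x : spanned (variable_iterated i) x -> forall b,
    spanned proper_iterated (j c * oop w (j b * x)).
  move=> vx b; rewrite -embedC; apply: spanned_mul_op vx => y vy.
  by apply/spanned_gen/ProperIterated/variable_iteratedZ.
have split_op x y : (forall w, spanned (variable_iterated i) (x * oop w y)) ->
    (forall v, spanned (variable_iterated i) (y * oop v x)) ->
    forall v w, spanned proper_iterated (oop v x * oop w y).
  move=> xy yx v w; apply: spanned_equiv (equivalent_op_mul _ _ _ _) _.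
  by apply: spannedD; exact: coef.
have base u w x : in_plus u -> variable_iterated i x ->
    spanned (variable_iterated i) (embed i u * oop w x).
  by move=> up vx; exact/spanned_gen/VIstep.
have step u v x w y : in_plus u ->
    spanned proper_iterated (oop v x * oop w y) ->
    spanned (variable_iterated i) (embed i u * oop v x * oop w y).
  by rewrite -mulrA; exact: spanned_variable_iteratedM.
move=> vz; elim: vz z' => {z} [u up|u v0 z up vz IHz] z' vz'.
  elim: vz' => {z'} [u' up'|u' w0 z' up' vz' IHz']; apply: split_op => w.
  - exact/base/VIbase.
  - exact/base/VIbase.
  - exact/base/VIstep.
  - by apply: step => //; rewrite mulrC; exact: IHz'.
elim: vz' => {z'} [u' up'|u' w0 z' up' vz' IHz']; apply: split_op => w.
- by apply: step => //; exact/IHz/VIbase.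
- exact/base/VIstep.
- by apply: step => //; exact/IHz/VIstep.
- by apply: step => //; rewrite mulrC; exact: IHz'.
Qed.

(** * Stability of sums of iterated integrals *)

Local Notation integral_sum := (spanned (iterated_integral i)).

Lemma integral_sumM x y : integral_sum x -> integral_sum y ->
  integral_sum (x * y).
Proof.
move=> ix; apply: spanned_mull => {}y iy.
rewrite mulrC; apply: spanned_mull ix => {}x ix.
case: iy ix => [v|v w z vz] [u|u w' z' vz'].
- by rewrite -embedM; exact/spanned_gen/IIbase.
- by rewrite mulrA -embedM; exact/spanned_gen/IIstep.
- by rewrite mulrC mulrA -embedM; exact/spanned_gen/IIstep.
- rewrite mulrACA -embedM; apply: spanned_mull (spanned_op_mul vz vz' _ _).
  by move=> _ [u0 w0 z0 vz0]; rewrite mulrA -embedM; exact/spanned_gen/IIstep.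
Qed.

(** The leading coefficient u_0 becomes an inner factor under the operator, so
it is split into its part in A[Y]^+, which is admissible there, and its
constant term, which [equivalent_op_op] moves outside. *)
Lemma integral_sum_op w x : integral_sum x -> integral_sum (oop w x).
Proof.
have op1 z : variable_iterated i z -> integral_sum (oop w z).
  have j1 : j 1 = 1 by exact: rmorph1.
  move=> vz; rewrite -[oop w z]mul1r -j1 -embedC.
  exact/spanned_gen/IIstep.
have opD y z : oop w (y + z) = oop w y + oop w z by exact: raddfD.
apply: spanned_map => [y z|y z|{}x]; first exact: raddfB.
  exact: equivalent_op.
have decomp u : embed i u =
    j (mcoeff mone u) + embed i (u - mkmalgU mone (mcoeff mone u)).
  by rewrite -embedC -embedD addrC subrK.
case=> [u|u v z vz]; rewrite decomp; set c := mcoeff _ u.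
  rewrite opD; apply: spannedD; last exact/op1/VIbase/in_plusB_const.
  rewrite -(structure_mapP F w c : j (oop w c) = oop w (j c)) -embedC.
  exact/spanned_gen/IIbase.
rewrite mulrDl opD; apply: spannedD; last first.
  by apply/op1/VIstep => //; exact: in_plusB_const.
apply: spanned_equiv (equivalent_op_op _ _ _ _) _.
rewrite -mulNr -raddfN /= -!embedC.
apply: spannedD; apply/spanned_gen/IIstep => //; rewrite embedC.
exact: variable_iteratedZ.
Qed.

Lemma integral_sum_teval t : integral_sum (teval (fun y => i (mvar y)) t).
Proof.
elim: t => [c|y|s IHs t IHt|s IHs t IHt|w t IHt] /=.
- by rewrite -embedC; exact/spanned_gen/IIbase.
- by rewrite -embedX; exact/spanned_gen/IIbase.
- exact: spannedD.
- exact: integral_sumM.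
- exact: integral_sum_op.
Qed.

End Reduction.

(** * Generators of a free algebra *)

(** Freeness gives a map g to the algebra of terms modulo the axioms, and
evaluation of terms gives a map l back; l o g extends i, so by uniqueness it
is the identity, and any term representing g(x) evaluates to x. *)
Lemma free_rho_algebra_generated (R : comNzRingType) (Omega : Type)
    (A : operated_algebra R Omega) (Y : choiceType) (F : rho_algebra A)
    (i : {lrmorphism mvpoly R Y -> F}) (x : F) : is_free_rho_algebra i ->
  exists t, x = teval (fun y => i (mvar y)) t.
Proof.
move=> Ffree.
have [g [[gop gst] gi _]] := Ffree _ (@free_var R Omega A Y).
pose l : {lrmorphism free_rho_algebra -> F} :=
  @free_lift R Omega A Y F (fun y => i (mvar y)).
have [lop lst] : is_rho_hom l := @free_lift_rho_hom R Omega A Y F _.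
have [e [_ _ eU]] := Ffree F i.
have E1 : x = e x by apply: (eU idfun).
have E2 : l (g x) = e x.
  apply: (eU (l \o g)).
    by split=> [w y|y] /=; [rewrite gop lop|rewrite gst lst].
  move=> p; apply: (@poly_hom_ext R Y F (l \o (g \o i)) i) => y /=.
  by rewrite gi [free_var _]poly_evalX; exact: (free_liftE _ (TVar y)).
rewrite E1 -E2.
by eexists; reflexivity.
Qed.

(** * Integration by parts in C(I) *)

(** The lower limit may lie on either side of x; the integral is rewritten with
a lower limit p below x and at most a, to which the fundamental theorem of
calculus applies. *)
Lemma oriented_integral_is_derive (R : realType) (I : open_interval R)
    (g : R -> R) (a x : R) :
  {within (oi_set I), continuous g} -> oi_set I a -> oi_set I x ->
  is_derive x 1 (fun y => oriented_integral a y g) (g x).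
Proof.
move=> cg Ia Ix.
have nI : nbhs x (oi_set I).
  by apply: open_nbhs_nbhs; split=> //; exact: oi_open.
have /nbhs_ballP[e /= e0 eI] := nI.
have near d : `|d| < e -> oi_set I (x + d).
  by move=> de; apply: eI; rewrite /ball /= opprD addNKr normrN.
have e2 : `|e / 2| < e.
  by rewrite gtr0_norm ?divr_gt0// ltr_pdivrMr// ltr_pMr// ltr1n.
have e20 : 0 < e / 2 by rewrite divr_gt0.
(* The interval [p, x + e/2] lies in I, contains x in its interior and
   does not start after a. *)
pose p := Num.min a (x - e / 2).
have Ip : oi_set I p.
  by rewrite /p /Num.min; case: ifP => // _; apply: near; rewrite normrN.
have px : p < x by rewrite /p gt_min gtrDl oppr_lt0 e20 orbT.
have pa : p <= a by rewrite /p ge_min lexx.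
have xu : x < x + e / 2 by rewrite ltrDl.
have Iu : oi_set I (x + e / 2) by exact: near.
have gx : {for x, continuous g}.
  move: cg; rewrite continuous_open_subspace; last exact: oi_open.
  by apply; exact/mem_set.
have [dF F'] := continuous_FTC1_closed xu (oi_integrable cg Ip Iu) px gx.
have dG : is_derive x 1 (fun y => \int[lebesgue_measure]_(t in `[p, y]) g t -
    \int[lebesgue_measure]_(t in `[p, a]) g t) (g x).
  rewrite -[g x]subr0 -F' derive1E; apply: is_deriveB; exact: derivableP.
apply: near_eq_is_derive dG.
near=> y.
have Iy : oi_set I y by near: y.
have py : p <= y by apply/ltW; near: y; exact: lt_nbhsr.
by rewrite (oriented_integral_shift cg Ip Ia Iy pa py).
Unshelve. all: by end_near. Qed.

Lemma derive0_eq (R : realType) (I : open_interval R) (f : R -> R) (a x : R) :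
  (forall y, oi_set I y -> is_derive y 1 f 0) -> oi_set I a -> oi_set I x ->
  f x = f a.
Proof.
move=> f0; wlog ax : a x / a < x => [wl Ia Ix|Ia Ix].
  by have [ax|xa|->] := ltgtP a x; [exact: wl|rewrite (wl x a)|].
have ain y : y \in `[a, x] -> oi_set I y by exact: oi_sub.
have := MVT ax (df := fun=> 0) (f := f).
case=> [y /subset_itv_oo_cc/ain Iy||c _ /eqP].
- exact: f0.
- apply: derivable_within_continuous => y /ain/f0 dy.
  exact: ex_derive.
- by rewrite mul0r subr_eq0 => /eqP.
Qed.

Section Volterra.
Context {R : realType} {I : open_interval R} {a : I}.
Implicit Types (f g : CI a).

(** The operator Q: integration from the base point. *)
Definition primitive f : CI a := volterra_op 1 1 f.
Local Notation ext f := ('valL_0 (CIfun f)).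

Lemma extE f (x : I) : ext f (\val x) = f x.
Proof. by have := valLK 0 (CIfun f) => /(congr1 (fun h => h x)). Qed.

Lemma primitiveE f x :
  primitive f x = oriented_integral (\val a) (\val x) (ext f).
Proof. by rewrite /primitive volterra_opE !mul1r. Qed.

Lemma volterra_op_primitive k h f : volterra_op k h f = k * primitive (h * f).
Proof. by apply: CIext => x; rewrite volterra_opE CIME primitiveE. Qed.

Lemma primitive_is_derive f x : oi_set I x ->
  is_derive x 1 (fun y => oriented_integral (\val a) y (ext f)) (ext f x).
Proof.
apply: oriented_integral_is_derive; first exact: valL_CI_continuous.
exact: set_mem (valP a).
Qed.

(** Both sides vanish at a and have the same derivative on I. *)
Lemma primitiveM f g :
  primitive f * primitive g = primitive (f * primitive g + g * primitive f).
Proof.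
apply: CIext => x; rewrite CIME !primitiveE.
pose T (h : CI a) y := oriented_integral (\val a) y (ext h).
have Ia : oi_set I (\val a) := set_mem (valP a).
have Ix : oi_set I (\val x) := set_mem (valP x).
have T0 h : T h (\val a) = 0.
  by rewrite /T /oriented_integral lexx set_itv1 Rintegral_set1.
apply/eqP; rewrite -subr_eq0; apply/eqP.
have := @derive0_eq R I (fun y => T f y * T g y -
  T (f * primitive g + g * primitive f) y) _ _ _ Ia Ix.
rewrite !T0 mul0r subrr; apply => y Iy.
have df := primitive_is_derive f Iy; have dg := primitive_is_derive g Iy.
have dfg := primitive_is_derive (f * primitive g + g * primitive f) Iy.
apply: is_derive_eq.
(* The primitives in the integrand are only known at points of I. *)
pose y' : I := SigSub (mem_set Iy).
have -> : y = \val y' by [].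
rewrite !extE CIDE !CIME !primitiveE /T.
by apply/eqP; rewrite subr_eq0 addrC; apply/eqP; congr (_ + _); exact: mulrC.
Qed.

Lemma primitiveD f g : primitive (f + g) = primitive f + primitive g.
Proof. exact: raddfD. Qed.

Lemma CI_inv_continuous f :
  (forall x, f x != 0) -> continuous (fun x => (f x)^-1).
Proof.
move=> f0 x; refine (@continuousV R (I : topologicalType) f x (f0 x) _).
exact: CI_continuous.
Qed.

Definition CI_inv f (f0 : forall x, f x != 0) : CI a :=
  MkCI (CI_inv_continuous f0).

Lemma CI_mulV f (f0 : forall x, f x != 0) : f * CI_inv f0 = 1.
Proof. by apply: CIext => x; rewrite CIME mulfV. Qed.

(** Integration by parts for h f and h' g; the inserted k' kinv' = 1 and
k kinv = 1 turn the inner primitives back into Volterra operators. *)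
Lemma volterra_rota_baxter k k' h h' kinv kinv' f g :
  k * kinv = 1 -> k' * kinv' = 1 ->
  volterra_op k h f * volterra_op k' h' g =
  k' * volterra_op k h (kinv' * (f * volterra_op k' h' g)) +
  k * volterra_op k' h' (kinv * (g * volterra_op k h f)).
Proof.
move=> kK kK'; rewrite !volterra_op_primitive.
rewrite mulrACA primitiveM primitiveD mulrDr.
have cancel (u v b c t : CI a) : u * v = 1 ->
    b * c * t = b * (v * (c * (u * t))).
  move=> uv; rewrite [c * (u * t)]mulrCA [v * (u * _)]mulrA [v * u]mulrC uv.
  by rewrite mul1r mulrA.
rewrite (cancel _ _ h f _ kK') (cancel _ _ h' g _ kK).
by congr (_ + _); rewrite -[k * k' * _]mulrA // mulrCA.
Qed.

End Volterra.

(** * Operator linear representatives *)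

Theorem theorem4p6 (R : realType) (I : open_interval R) (a : I)
  (Omega : Type) (Omega_nonempty : inhabited Omega)
  (k h : Omega -> CI a) (k_neq0 : forall (w : Omega) (x : I), k w x != 0)
  (Y : choiceType)
  (F : rho_algebra (volterra_algebra k h))
  (i : {lrmorphism mvpoly R Y -> F}) (F_free : is_free_rho_algebra i)
  (phi : F) :
  exists psi : F, equivalent i phi psi /\ operator_linear_on_variables i psi.
Proof.
have kK w : k w * CI_inv (k_neq0 w) = 1 := CI_mulV (k_neq0 w).
have rb v w f g := volterra_rota_baxter (h v) (h w) f g (kK v) (kK w).
have [t ->] := free_rho_algebra_generated phi F_free.
exact: spannedE (integral_sum_teval i kK rb t).
Qed.
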